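(* Let $X$ be a Banach space. Every weakly Dunford-Pettis operator $T\colon X\to X$ is weakly demi Dunford-Pettis.
   Context: Operators are bounded and linear. $X'$ and $X''$ denote the topological dual and bidual of $X$; weak convergence in $X$ is convergence in $\sigma(X,X')$ and weak convergence in $X'$ is convergence in $\sigma(X',X'')$. An operator $T\colon X\to X$ is weakly Dunford-Pettis if $f_j(T(x_j))\to 0$ whenever $x_j\to 0$ weakly in $X$ and $f_j\to 0$ weakly in $X'$. An operator $T\colon X\to X$ is weakly demi Dunford-Pettis if for all sequences $(x_j)_{j=1}^{\infty}$ in $X$ and $(f_j)_{j=1}^{\infty}$ in $X'$ with $x_j\to 0$ weakly in $X$, $f_j\to 0$ weakly in $X'$ and $\|x_j-T(x_j)\|\to 0$, one has $|f_j(x_j)|\to 0$ as $j\to\infty$. *)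

(* Defs.v *)
From HB Require Import structures.
From mathcomp Require Import all_boot all_order all_algebra.
From mathcomp Require Import boolp classical_sets functions reals.
From mathcomp Require Import topology normedtype.
From mathcomp Require Import complex.

Set Implicit Arguments.
Unset Strict Implicit.
Unset Printing Implicit Defensive.

Import Order.TTheory GRing.Theory Num.Theory.
Import numFieldNormedType.Exports.

Local Open Scope classical_set_scope.
Local Open Scope ring_scope.

(* The scalar fields: the axiom gives operator norms, which are suprema of
   nonnegative scalars.  It is used for the real field R and the complex field
   R[i], so that the notions below are defined once for both. *)
HB.mixin Record NumField_hasNormSup K of Num.NumField K := {
  norm_sup_exists : forall A : set K, A !=set0 -> (forall x, A x -> 0 <= x) ->
    ubound A !=set0 -> supremums A !=set0
}.

#[short(type="scalarFieldType")]
HB.structure Definition ScalarField :=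
  {K of Num.NumField K & NumField_hasNormSup K}.

Lemma real_norm_sup (R : realType) (A : set R) :
  A !=set0 -> (forall x, A x -> 0 <= x) -> ubound A !=set0 ->
  supremums A !=set0.
Proof.
move=> A0 _ Aub; exists (reals.sup A); split; first exact: ub_le_sup.
by move=> u uA; apply: ge_sup.
Qed.

#[non_forgetful_inheritance]
HB.instance Definition _ (R : realType) :=
  NumField_hasNormSup.Build R (@real_norm_sup R).

Lemma complex_norm_sup (R : realType) (A : set R[i]) :
  A !=set0 -> (forall x, A x -> 0 <= x) -> ubound A !=set0 ->
  supremums A !=set0.
Proof.
move=> [a Aa] A_ge0 [u uA].
have A_re x : A x -> x = (complex.Re x)%:C%C.
  by case: x => x y /A_ge0; rewrite lecE /= => /andP[/eqP -> _].
have [s [s_ub s_lub]] : supremums ((@complex.Re R) @` A) !=set0.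
  apply: real_norm_sup.
  - by exists (complex.Re a), a.
  - by move=> _ [x /A_ge0 + <-]; rewrite lecE => /andP[].
  - exists (complex.Re u) => _ [x /uA + <-].
    by rewrite lecE => /andP[].
exists s%:C%C; split=> [x Ax|v vA].
  by rewrite (A_re x Ax) lecR; apply: s_ub; exists x.
have v_ge0 : 0 <= v by apply: le_trans (vA _ Aa); exact: A_ge0.
rewrite lecE /=; apply/andP; split.
  by move: v_ge0; rewrite lecE => /andP[].
by apply: s_lub => _ [x /vA + <-]; rewrite lecE => /andP[].
Qed.

HB.instance Definition _ (R : realType) :=
  NumField_hasNormSup.Build R[i] (@complex_norm_sup R).

Section BoundedOperators.
Context (K : scalarFieldType) (X Y : normedModType K).

Definition bounded_linear : {pred X -> Y} :=
  [pred f | `[< linear f /\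
                exists M : K, forall x, `|f x| <= M * `|x| >] ].

Record bounded_op := BoundedOp {
  bounded_op_fun :> X -> Y;
  _ : bounded_op_fun \in bounded_linear
}.

HB.instance Definition _ := [isSub for bounded_op_fun].
HB.instance Definition _ := [Choice of bounded_op by <:].

Lemma bounded_op_linear (f : bounded_op) : linear f.
Proof. by have := valP f; rewrite inE => -[]. Qed.

HB.instance Definition _ (f : bounded_op) :=
  GRing.isLinear.Build K X Y _ f (bounded_op_linear f).

Lemma bounded_opP (f : bounded_op) :
  exists M : K, 0 <= M /\ forall x, `|f x| <= M * `|x|.
Proof.
have := valP f; rewrite inE => -[_ [M fM]].
have [[x x0]|X0] := pselect (exists x : X, x != 0).
  exists M; split => //; have := le_trans (normr_ge0 _) (fM x).
  by rewrite pmulr_lge0 // normr_gt0.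
exists 0; split=> // x; have -> : x = 0.
  by apply/eqP/negPn/negP => x0; apply: X0; exists x.
by rewrite linear0 !normr0 mul0r.
Qed.

Lemma bounded_linear_submod : submod_closed bounded_linear.
Proof.
split.
  rewrite inE; split; first by move=> a x y /=; rewrite scaler0 addr0.
  by exists 0 => x; rewrite mul0r normr0.
move=> a f g fB gB.
have [M [M0 fM]] := bounded_opP (BoundedOp fB).
have [N [N0 gN]] := bounded_opP (BoundedOp gB).
rewrite inE; split.
  move=> b x y /=.
  have fgE z : (a *: f + g) z = a *: f z + g z by [].
  have fL : linear f by move: (fB); rewrite inE => -[].
  have gL : linear g by move: (gB); rewrite inE => -[].
  rewrite !fgE fL gL.
  by rewrite !scalerDr !scalerA addrACA (mulrC a b).
exists (`|a| * M + N) => x; rewrite (le_trans (ler_normD _ _)) //.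
rewrite mulrDl; apply: lerD; last exact: gN.
by rewrite normrZ -mulrA ler_wpM2l.
Qed.

HB.instance Definition _ :=
  GRing.isSubmodClosed.Build K (X -> Y) bounded_linear bounded_linear_submod.
HB.instance Definition _ := [SubChoice_isSubLmodule of bounded_op by <:].

(* As for every norm over K in the library, the value lies in K itself; over
   R[i] the supremum is taken for the order 0 <= y - x, so it is a real. *)
Definition op_norm (f : bounded_op) : K :=
  supremum 0 [set `|f x| | x in [set x : X | `|x| <= 1]].

Lemma op_norm_supremums (f : bounded_op) :
  supremums [set `|f x| | x in [set x : X | `|x| <= 1]] (op_norm f).
Proof.
rewrite /op_norm /supremum; set A := (X in supremums X).
have A0 : A !=set0 by exists `|f 0|, 0 => //=; rewrite normr0.
rewrite ifN; last exact/set0P.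
have [||s sA] := norm_sup_exists A A0.
- by move=> _ [x _ <-].
- have [M [M0 fM]] := bounded_opP f; exists M => _ [x /= x1 <-].
  by rewrite (le_trans (fM x)) // ler_piMr.
- by case: xgetP => // /(_ s).
Qed.

Lemma op_norm_bound (f : bounded_op) x : `|f x| <= op_norm f * `|x|.
Proof.
have [->|x0] := eqVneq x 0; first by rewrite linear0 !normr0 mulr0.
have nx0 : 0 < `|x| by rewrite normr_gt0.
rewrite -ler_pdivrMr //; apply: (op_norm_supremums f).1.
exists (`|x|^-1 *: x); rewrite /= ?linearZ /= normrZ ger0_norm ?invr_ge0 //.
  by rewrite mulVf ?gt_eqF.
by rewrite mulrC.
Qed.

Lemma op_norm_le (f : bounded_op) (M : K) :
  0 <= M -> (forall x, `|f x| <= M * `|x|) -> op_norm f <= M.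
Proof.
move=> M0 fM; apply: (op_norm_supremums f).2 => _ [x /= x1 <-].
by rewrite (le_trans (fM x)) // ler_piMr.
Qed.

Lemma op_norm_ge0 (f : bounded_op) : 0 <= op_norm f.
Proof.
apply: (op_norm_supremums f).1; exists 0; first by rewrite /= normr0.
by rewrite linear0 normr0.
Qed.

Lemma op_norm_triangle (f g : bounded_op) :
  op_norm (f + g) <= op_norm f + op_norm g.
Proof.
apply: op_norm_le => [|x]; first by rewrite addr_ge0 ?op_norm_ge0.
rewrite mulrDl (le_trans (ler_normD _ _)) //.
by rewrite lerD ?op_norm_bound.
Qed.

Lemma op_normZ (a : K) (f : bounded_op) : op_norm (a *: f) = `|a| * op_norm f.
Proof.
have le_normZ b (g : bounded_op) : op_norm (b *: g) <= `|b| * op_norm g.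
  apply: op_norm_le => [|x]; first by rewrite mulr_ge0 ?op_norm_ge0.
  rewrite [X in `|X|](_ : _ = b *: g x) // normrZ -mulrA.
  by rewrite ler_wpM2l ?op_norm_bound.
apply/eqP; rewrite eq_le le_normZ /=.
have [->|a0] := eqVneq a 0; first by rewrite normr0 mul0r op_norm_ge0.
have na0 : 0 < `|a| by rewrite normr_gt0.
rewrite -ler_pdivlMl // -normfV.
by have := le_normZ a^-1 (a *: f); rewrite scalerA mulVf // scale1r.
Qed.

Lemma op_norm_eq0 (f : bounded_op) : op_norm f = 0 -> f = 0.
Proof.
move=> f0; apply/val_inj/funext => x /=; apply/eqP; rewrite -normr_le0.
by have := op_norm_bound f x; rewrite f0 mul0r.
Qed.

HB.instance Definition _ := Lmodule_isNormed.Build K bounded_op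
  op_norm_triangle op_normZ op_norm_eq0.

End BoundedOperators.

(* The dual carries the operator norm, so dual (dual X) is the bidual and
   weakly_null applied to a sequence in dual X is convergence to 0 in
   sigma(X', X''). *)
Notation dual X := (bounded_op X _^o).

Definition weakly_null (K : scalarFieldType) (X : normedModType K)
  (x : nat -> X) := forall f : dual X, f (x j) @[j --> \oo] --> (0 : K^o).

Section WeaklyDunfordPettis.
Context (K : scalarFieldType) (X : normedModType K).

Definition weakly_dunford_pettis (T : bounded_op X X) :=
  forall (x : nat -> X) (f : nat -> dual X),
    weakly_null x -> weakly_null f ->
    f j (T (x j)) @[j --> \oo] --> (0 : K^o).

Definition weakly_demi_dunford_pettis (T : bounded_op X X) :=
  forall (x : nat -> X) (f : nat -> dual X),
    weakly_null x -> weakly_null f ->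
    `|x j - T (x j)| @[j --> \oo] --> (0 : K^o) ->
    `|f j (x j)| @[j --> \oo] --> (0 : K^o).

End WeaklyDunfordPettis.

(* Main.v *)
Require Import Defs.
From mathcomp Require Import all_boot all_order all_algebra.
From mathcomp Require Import reals topology normedtype complex.
From mathcomp Require Import boolp classical_sets.

(** Write f_j(x_j) = f_j(x_j - T x_j) + f_j(T x_j).  The second term tends to 0
    because T is weakly Dunford-Pettis.  The first is at most
    C |x_j - T x_j|, where C bounds the norms of the f_j, and so tends to 0 by
    the hypothesis on x_j - T x_j.

    The bound C is where completeness of X enters.  A weakly null sequence in X'
    tends to 0 at every point of X, since evaluation at a point belongs to X''
    [weakly_null_pointwise]; it is thus pointwise bounded, and the uniform
    boundedness principle [uniform_boundedness] applies.

    The real and complex cases are treated at once, over a field K in which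
    norm suprema exist.  The order of K is only partial, but norms, being
    nonnegative, are comparable with each other, and the existence of suprema
    makes them archimedean [scalar_archimedean].  These two facts are what the
    nested balls behind the uniform boundedness principle require of K. *)

Local Open Scope ring_scope.

Set Implicit Arguments.
Unset Strict Implicit.
Unset Printing Implicit Defensive.

Import Order.TTheory GRing.Theory Num.Theory.
Import numFieldNormedType.Exports.

Local Open Scope classical_set_scope.

(** If every natural number were below x, their supremum s would exist, and
    s - 1 would be a smaller upper bound. *)
Lemma scalar_archimedean (K : scalarFieldType) (x : K) :
  0 <= x -> exists n : nat, x < n%:R.
Proof.
move=> x_ge0; apply: contrapT => nx.
have nat_le_x (n : nat) : n%:R <= x.
  rewrite real_leNgt ?ger0_real //; apply/negP => ?.
  by apply: nx; exists n.
have [] := @norm_sup_exists K (range (fun n : nat => n%:R : K)).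
- by exists 0, 0%N.
- by move=> _ [n _ <-].
- by exists x => _ [n _ <-].
move=> s [s_ub s_lub].
have /s_lub : ubound (range (fun n : nat => n%:R : K)) (s - 1).
  by move=> _ [n _ <-]; rewrite lerBrDr natr1; apply: s_ub; exists n.+1.
by rewrite lerDl oppr_ge0 ler10.
Qed.

Section UniformBoundedness.
Context (K : scalarFieldType).

(** Around 0 the bound is M + M, as the difference of two values on the given
    ball; homogeneity then spreads it to the whole space. *)
Lemma bound_from_ball (X Y : normedModType K) (g : bounded_op X Y) (x : X)
    (r M : K) : 0 < r -> (forall z, `|x - z| <= r -> `|g z| <= M) ->
  forall u, `|g u| <= (M + M) / r * `|u|.
Proof.
move=> r_gt0 gM u.
have [->|u_neq0] := eqVneq u 0; first by rewrite linear0 !normr0 mulr0.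
have u_gt0 : 0 < `|u| by rewrite normr_gt0.
have ru_ge0 : 0 <= r / `|u| by rewrite divr_ge0 // ltW.
pose v := (r / `|u|) *: u.
have v_norm : `|v| = r.
  by rewrite normrZ ger0_norm // divfK ?gt_eqF.
have gv : `|g v| <= M + M.
  have -> : g v = g (x + v) - g x by rewrite -linearB addrC addKr.
  apply: le_trans (ler_normB _ _) _; apply: lerD; apply: gM.
    by rewrite opprD addNKr normrN v_norm.
  by rewrite subrr normr0 ltW.
have : r / `|u| * `|g u| <= M + M.
  by move: gv; rewrite linearZ normrZ ger0_norm.
rewrite mulrAC ler_pdivrMr // => ruM.
by rewrite mulrAC ler_pdivlMr // mulrC.
Qed.

Context (X Y : normedModType K) (I : Type) (f : I -> bounded_op X Y).

Definition equibounded := exists C, forall i u, `|f i u| <= C * `|u|.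

(** The step that is iterated below: by [bound_from_ball] the family exceeds M
    at some point of the ball of radius r / 2, and by continuity it still does
    on a small ball around that point.  Closed balls are used, so that a limit
    of centres stays inside; s + s <= r makes the radii tend to 0. *)
Lemma escape_ball (x : X) (r M : K) :
  ~ equibounded -> 0 < r -> 0 <= M ->
  exists y s, [/\ 0 < s, s + s <= r, `|x - y| + s <= r &
    exists i, forall z, `|y - z| <= s -> M < `|f i z| ].
Proof.
move=> unbounded r_gt0 M_ge0; pose h := r / 2.
have h_gt0 : 0 < h by rewrite divr_gt0.
have hh : h + h = r by rewrite -splitr.
have [i [y [xy My]]] : exists i y, `|x - y| <= h /\ M < `|f i y|.
  apply: contrapT => no_escape; apply: unbounded.
  exists ((M + M) / h) => i; apply: (bound_from_ball (x := x) h_gt0) => z xz.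
  rewrite real_leNgt ?ger0_real //; apply/negP => Mz.
  by apply: no_escape; exists i, z.
have [N [N_ge0 fN]] := bounded_opP (f i).
have gap_gt0 : 0 < `|f i y| - M by rewrite subr_gt0.
(* A radius below t changes f i by less than the gap; N + 1 makes the quotient
   meaningful when N = 0. *)
pose t := (`|f i y| - M) / (N + 1).
have N1_gt0 : 0 < N + 1 by rewrite ltr_wpDl.
have t_gt0 : 0 < t by rewrite divr_gt0.
have Nt : N * t < `|f i y| - M.
  by rewrite mulrCA gtr_pMr // ltr_pdivrMr // mul1r ltrDl.
have [s [s_gt0 sh st]] : exists s, [/\ 0 < s, s <= h & s <= t].
  have [ht|th] := orP (ger_leVge (ltW h_gt0) (ltW t_gt0)).
    by exists h.
  by exists t.
exists y, s; split => //; first by rewrite -hh lerD.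
  by rewrite -hh lerD.
exists i => z yz.
have fyz : `|f i (y - z)| < `|f i y| - M.
  apply: le_lt_trans Nt; apply: le_trans (fN _) _.
  by rewrite ler_wpM2l // (le_trans yz).
have : `|f i y| < `|f i z| + (`|f i y| - M).
  apply: le_lt_trans (_ : `|f i z| + `|f i (y - z)| < _).
    by rewrite linearB -{1}(subrK (f i z) (f i y)) addrC ler_normD.
  by rewrite ltrD2l.
by rewrite addrCA ltrDl subr_gt0.
Qed.

End UniformBoundedness.

(** Otherwise [escape_ball] yields nested closed balls, on the n-th of which
    some member of the family exceeds n - 1 in norm.  Their centres converge to
    a point common to all the balls, where the family is unbounded. *)
Lemma uniform_boundedness (K : scalarFieldType) (X : completeNormedModType K)
    (Y : normedModType K) (I : Type) (f : I -> bounded_op X Y) :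
  (forall x, exists M, forall i, `|f i x| <= M) -> equibounded f.
Proof.
move=> pw_bounded; apply: contrapT => unbounded.
pose esc n (p q : X * K) := [/\ 0 < q.2, q.2 + q.2 <= p.2,
  `|p.1 - q.1| + q.2 <= p.2 &
  exists i, forall z, `|q.1 - z| <= q.2 -> n%:R < `|f i z| ].
(* A pair is a centre and a radius.  The choice is made for all pairs, hence the
   positivity premise; along the sequence B it always holds. *)
have /choice[F FP] (np : nat * (X * K)) :
    exists q, 0 < np.2.2 -> esc np.1 np.2 q.
  have [r_gt0|] := pselect (0 < np.2.2); last by exists np.2.
  have [y [s ?]] := escape_ball np.2.1 unbounded r_gt0 (ler0n K np.1).
  by exists (y, s).
pose B := fix B n := if n is m.+1 then F (m, B m) else (0 : X, 1 : K).
pose c n := (B n).1; pose r n := (B n).2.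
have r_gt0 n : 0 < r n.
  by elim: n => [|n IH]; [exact: ltr01 | case: (FP (n, B n) IH)].
have r_half n : r n.+1 + r n.+1 <= r n by case: (FP (n, B n) (r_gt0 n)).
have ball_step n : `|c n - c n.+1| + r n.+1 <= r n.
  by case: (FP (n, B n) (r_gt0 n)).
have large n : exists i, forall z, `|c n.+1 - z| <= r n.+1 -> n%:R < `|f i z|.
  by case: (FP (n, B n) (r_gt0 n)).
have nested n k : `|c n - c (n + k)%N| + r (n + k)%N <= r n.
  elim: k => [|k IH]; first by rewrite addn0 subrr normr0 add0r.
  apply: le_trans IH; rewrite addnS.
  apply: le_trans (_ : `|c n - c (n + k)%N| +
    (`|c (n + k)%N - c (n + k).+1| + r (n + k).+1) <= _).
    by rewrite addrA lerD2r ler_distD.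
  by rewrite lerD2l.
have near_c n k : (n <= k)%N -> `|c n - c k| <= r n.
  move=> /subnKC <-; apply: le_trans (nested n (k - n)%N).
  by rewrite lerDl ltW.
(* Halving gives r n <= 2^-n; this weaker form compares directly with the
   archimedean property. *)
have r_small n : r n * n.+1%:R <= 1.
  elim: n => [|n IH]; first by rewrite mulr1.
  apply: le_trans IH; apply: le_trans (_ : (r n.+1 + r n.+1) * n.+1%:R <= _).
    rewrite mulrDl -mulrDr -natrD ler_wpM2l ?ler_nat ?ltW //.
    by rewrite addnS ltnS leq_addr.
  by rewrite ler_wpM2r.
have /cauchy_cvg c_cvg : cauchy (c @ \oo).
  apply: cauchy_exP => e e_gt0.
  have [n] := scalar_archimedean (ltW (divr_gt0 ltr01 e_gt0)).
  rewrite ltr_pdivrMr // => ne.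
  exists (c n), n => // k /= nk; rewrite -ball_normE /=.
  apply: le_lt_trans (near_c _ _ nk) _.
  have n1_gt0 : (0 : K) < n.+1%:R by rewrite ltr0n.
  rewrite -(ltr_pM2r n1_gt0); apply: le_lt_trans (r_small n) _.
  by apply: lt_le_trans ne _; rewrite mulrC ler_wpM2l ?ler_nat ?ltW.
pose l := lim (c @ \oo).
have l_near n : `|c n - l| <= r n.
  apply/ler_addgt0Pr => e e_gt0.
  have /cvgrPdist_lt/(_ e e_gt0)[N _ cN] : c @ \oo --> l by exact: c_cvg.
  apply: le_trans (ler_distD (c (maxn n N)) _ _) _.
  by rewrite lerD ?near_c ?leq_maxl // distrC ltW // cN //= leq_maxr.
have [M fM] := pw_bounded l.
have [i0 _] := large 0%N.
have [n Mn] := scalar_archimedean (le_trans (normr_ge0 _) (fM i0)).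
have [i /(_ l (l_near _)) fi] := large n.
by have := lt_trans Mn (lt_le_trans fi (fM i)); rewrite ltxx.
Qed.

Section WeaklyNull.
Context (K : scalarFieldType) (X : normedModType K).

Lemma evaluation_bounded (x : X) :
  (fun g : dual X => g x) \in @bounded_linear K (dual X) K^o.
Proof.
rewrite inE; split => //.
by exists `|x| => g; rewrite mulrC; exact: op_norm_bound.
Qed.

Definition evaluation (x : X) : dual (dual X) :=
  BoundedOp (evaluation_bounded x).

Lemma weakly_null_pointwise (f : nat -> dual X) (x : X) :
  weakly_null f -> f j x @[j --> \oo] --> (0 : K^o).
Proof. by move/(_ (evaluation x)). Qed.

End WeaklyNull.

Lemma weakly_null_dual_equibounded (K : scalarFieldType)
    (X : completeNormedModType K) (f : nat -> dual X) :
  weakly_null f -> equibounded f.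
Proof.
move=> f0; apply: uniform_boundedness => x.
have /cvgP/cvg_seq_bounded[M [Mr fM]] := weakly_null_pointwise x f0.
by exists (M + 1) => j; apply: fM => //; rewrite ltrDl.
Qed.

Lemma weakly_dunford_pettis_demi (K : scalarFieldType)
    (X : completeNormedModType K) (T : bounded_op X X) :
  weakly_dunford_pettis T -> weakly_demi_dunford_pettis T.
Proof.
move=> TDP x f x0 f0 xTx0.
have [C fC] := weakly_null_dual_equibounded f0.
have f_split j :
    `|f j (x j)| <= C * `|x j - T (x j)| + `|f j (T (x j))|.
  rewrite -{1}(subrK (T (x j)) (x j)) linearD.
  by rewrite (le_trans (ler_normD _ _)) // lerD2r fC.
have fT0 : `|f j (T (x j))| @[j --> \oo] --> (0 : K^o).
  by apply/norm_cvg0P; exact: TDP.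
have bound0 :
    (C * `|x j - T (x j)| + `|f j (T (x j))| : K^o) @[j --> \oo] --> (0 : K^o).
  rewrite -[X in _ --> X]addr0 -[X in _ --> X + _](mulr0 C).
  by apply: cvgD => //; apply: cvgM xTx0; exact: cvg_cst.
apply/norm_cvg0P/cvgr0Pnorm_le => e e_gt0.
have /cvgr0Pnorm_le/(_ e e_gt0) := bound0; apply: filterS => j.
apply: le_trans; apply: le_trans (f_split j) _.
by apply: real_ler_norm; apply: ger0_real; apply: le_trans (f_split j).
Qed.

Theorem proposition2p3 (R : realType) :
  (forall (X : completeNormedModType R) (T : bounded_op X X),
    weakly_dunford_pettis T -> weakly_demi_dunford_pettis T) /\
  (forall (X : completeNormedModType R[i]) (T : bounded_op X X),
    weakly_dunford_pettis T -> weakly_demi_dunford_pettis T).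
Proof.
split=> X T; exact: weakly_dunford_pettis_demi.
Qed.
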